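(* Let $(X,\operatorname{dist})$ be a compact metric space with infinitely many points and let $f\colon X\to X$ be an expansive homeomorphism. Then the polynomial entropy of $f$ satisfies $h_{pol}(f)\geq 1$.
   Context: A homeomorphism $f\colon X\to X$ of a compact metric space $(X,\operatorname{dist})$ is expansive if there exists $\delta>0$ such that whenever $x,y\in X$ satisfy $\operatorname{dist}(f^n(x),f^n(y))<\delta$ for all $n\in\mathbb{Z}$, then $x=y$. Polynomial entropy: for $n\geq 1$ and $\varepsilon>0$, a set $E\subset X$ is $(n,\varepsilon)$-spanning for $f$ if for each $y\in X$ there is $x\in E$ with $\operatorname{dist}(f^k(x),f^k(y))\leq\varepsilon$ for all $0\leq k\leq n-1$. Let $r_n(\varepsilon)$ be the minimum cardinality of an $(n,\varepsilon)$-spanning set. Define $h_{pol}^{\varepsilon}(f)=\limsup_{n\to\infty}\frac{\log r_n(\varepsilon)}{\log n}$ and $h_{pol}(f)=\lim_{\varepsilon\to 0}h_{pol}^{\varepsilon}(f)\in[0,\infty]$ (the limit exists by monotonicity in $\varepsilon$). *)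

(* Defs.v *)
From HB Require Import structures.
From mathcomp Require Import all_boot all_order all_algebra.
From mathcomp Require Import all_classical all_reals all_analysis.
Set Implicit Arguments.
Unset Strict Implicit.
Unset Printing Implicit Defensive.
Import Order.TTheory GRing.Theory Num.Theory.
Import numFieldNormedType.Exports.
Local Open Scope classical_set_scope.
Local Open Scope ring_scope.

Record homeomorphism (X : topologicalType) := Homeomorphism {
  homeo_fun :> X -> X;
  homeo_inv : X -> X;
  homeo_funK : cancel homeo_fun homeo_inv;
  homeo_invK : cancel homeo_inv homeo_fun;
  homeo_fun_continuous : continuous homeo_fun;
  homeo_inv_continuous : continuous homeo_inv
}.

(* [Negz k] is the integer - (k + 1). *)
Definition homeo_iter (X : topologicalType) (f : homeomorphism X) (n : int)
    (x : X) : X :=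
  match n with
  | Posz k => iter k f x
  | Negz k => iter k.+1 (homeo_inv f) x
  end.

Definition expansive (R : realType) (X : metricType R) (f : homeomorphism X)
    : Prop :=
  exists2 delta : R, 0 < delta &
    forall x y : X,
      (forall n : int, mdist (homeo_iter f n x) (homeo_iter f n y) < delta) ->
      x = y.

Section polynomial_entropy.
Context {R : realType} {X : metricType R}.
Implicit Types (f : X -> X) (n : nat) (eps : R) (E : set X).

Definition spanning f n eps E : Prop :=
  forall y : X, exists2 x : X, E x &
    forall k : nat, (k < n)%N -> mdist (iter k f x) (iter k f y) <= eps.

Definition spanning_cardinals f n eps : set nat :=
  [set m | exists2 E : set X, spanning f n eps E & (E #= `I_m)%card].

(* The least element of [spanning_cardinals f n eps]. The default value 0 is
   used only if there is no finite spanning set, which cannot happen when X is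
   compact, f is continuous and eps > 0. *)
Definition spanning_number f n eps : nat :=
  xget 0%N [set m | spanning_cardinals f n eps m /\
    forall k : nat, spanning_cardinals f n eps k -> (m <= k)%N].

(* The terms n = 0, 1, where ln n%:R = 0, do not affect the upper limit. *)
Definition pol_entropy_at f eps : \bar R :=
  limn_esup (fun n : nat =>
    (ln (spanning_number f n eps)%:R / ln n%:R)%:E).

Definition pol_entropy f : \bar R :=
  lim (pol_entropy_at f eps @[eps --> (0 : R)^'+]).

End polynomial_entropy.

(* Main.v *)
(**
Fix an expansivity constant [delta] and [0 < e < delta], and count orbit
segments of length [n] up to [e]-closeness, as the words of length [n] of a
subshift are counted in the Morse-Hedlund theorem. By compactness, if two
orbits are [e]-close during a time window, they are [e/4]-close during the
window shortened by some fixed [N] on both sides. Suppose that [k] points are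
[(n, e)]-separated and that, after moving them by [f^-(N+1)], they cannot be
completed to [k + 1] points that are [(n + 2(N+1), e)]-separated. Then they
span, so being [e/2]-close during [n] steps forces being [e/2]-close one step
further in both directions, hence forever; by expansivity there are only [k]
points. On an infinite space the number of separated orbit segments therefore
grows at least linearly in [n].
*)
Require Import Defs.
From mathcomp Require Import all_boot all_order all_algebra.
From mathcomp Require Import all_classical all_reals all_analysis.
From mathcomp Require Import lra zify.
Set Implicit Arguments.
Unset Strict Implicit.
Unset Printing Implicit Defensive.
Import Order.TTheory GRing.Theory Num.Theory.
Import numFieldNormedType.Exports.
Local Open Scope classical_set_scope.
Local Open Scope ring_scope.

(** * Continuity of the metric and of iterates *)

Section metric_continuity.
Context {R : realType} {X : metricType R}.
Implicit Types (g : X -> X) (x y : X).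

Lemma near_mdist_lt x (e : R) : 0 < e -> \forall x' \near x, mdist x x' < e.
Proof.
by move=> e0; have := nbhsx_ballx x e e0; rewrite ballEmdist.
Qed.

Lemma ler_dist_mdist (x y x' y' : X) :
  `|mdist x y - mdist x' y'| <= mdist x x' + mdist y y'.
Proof.
rewrite ler_norml; apply/andP; split.
  have := metric_triangle x' x y'; have := metric_triangle x y y'.
  by rewrite (metric_sym x' x); lra.
have := metric_triangle x x' y; have := metric_triangle x' y' y.
by rewrite (metric_sym y' y); lra.
Qed.

Lemma mdist_continuous : continuous (fun p : X * X => mdist p.1 p.2).
Proof.
move=> [x y]; apply/cvgrPdist_lt => e e0.
have e2 : 0 < e / 2 by lra.
exists ([set x' | mdist x x' < e / 2], [set y' | mdist y y' < e / 2]).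
  by split; exact: near_mdist_lt.
move=> [x' y'] [/= xx' yy'].
by apply: le_lt_trans (ler_dist_mdist _ _ _ _) _; lra.
Qed.

Lemma mdist_comp_continuous g : continuous g ->
  continuous (fun p : X * X => mdist (g p.1) (g p.2)).
Proof.
move=> cg [x y].
apply: (@continuous2_cvg _ _ _ _ _ _ (fun p : X * X => g p.1)
  (fun p => g p.2) mdist); first exact: (@mdist_continuous (g x, g y)).
  by apply: continuous_cvg; [exact: cg|exact: cvg_fst].
by apply: continuous_cvg; [exact: cg|exact: cvg_snd].
Qed.

Lemma iter_continuous g k : continuous g -> continuous (iter k g).
Proof.
move=> cg; elim: k => [|k IHk] x; first exact: cvg_id.
by apply: (@continuous_cvg _ _ _ _ _ _ g); [exact: cg|exact: IHk].
Qed.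

End metric_continuity.

(** * Separated and spanning sets of orbit segments *)

Section shadowing.
Context {R : realType} {X : metricType R}.
Implicit Types (f : X -> X) (x y z : X) (n k : nat) (e : R) (p : nat -> X).

Definition orbit_close f n e x y :=
  forall k, (k < n)%N -> mdist (iter k f x) (iter k f y) <= e.

(** For [0 <= e] the conclusion [i = j] also makes [p] injective below [k], so [k] counts distinct
    points. *)
Definition separated f n e k p :=
  forall i j, (i < k)%N -> (j < k)%N -> orbit_close f n e (p i) (p j) -> i = j.

Lemma orbit_close_sym f n e x y :
  orbit_close f n e x y -> orbit_close f n e y x.
Proof. by move=> xy k kn; rewrite metric_sym; exact: xy. Qed.

Lemma orbit_close_trans f n e1 e2 e y x z : e1 + e2 <= e ->
  orbit_close f n e1 x y -> orbit_close f n e2 y z -> orbit_close f n e x z.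
Proof.
move=> e12 xy yz k kn; apply: le_trans (metric_triangle _ (iter k f y) _) _.
by apply: le_trans e12; apply: lerD; [exact: xy|exact: yz].
Qed.

Lemma orbit_close_weaken f m n e e' x y : (n <= m)%N -> e <= e' ->
  orbit_close f m e x y -> orbit_close f n e' x y.
Proof.
by move=> nm ee' xy k kn; apply: le_trans ee'; apply: xy; exact: leq_trans nm.
Qed.

Lemma orbit_close_iter f m n e x y :
  orbit_close f (m + n) e x y -> orbit_close f n e (iter m f x) (iter m f y).
Proof. by move=> xy k kn; rewrite -!iterD; apply: xy; lia. Qed.

Lemma separated_leq f m n e k p : (m <= n)%N ->
  separated f m e k p -> separated f n e k p.
Proof.
by move=> mn sp i j ik jk pij; apply: sp => //; exact: orbit_close_weaken pij.
Qed.

(** Two separated points cannot share an [eps]-close centre in [E], so choosing centres is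
    injective. *)
Lemma separated_card f n e eps k p (E : set X) m :
  separated f n e k p -> eps + eps <= e -> spanning f n eps E ->
  (E #= `I_m)%card -> (k <= m)%N.
Proof.
move=> sp epse sE Em.
have /choice[s sP] : forall i, exists x, E x /\ orbit_close f n eps x (p i).
  by move=> i; have [x Ex xp] := sE (p i); exists x.
have s_inj : {in `I_k &, injective s}.
  move=> i j; rewrite !inE => ik jk sij; apply: sp => //.
  have [[_ si] [_ sj]] := (sP i, sP j).
  by apply: orbit_close_trans epse (orbit_close_sym si) _; rewrite sij.
rewrite -card_le_II -(card_le_eqr Em) -(card_le_eql (inj_card_eq s_inj)).
by apply: subset_card_le => _ [i _ <-]; exact: (sP i).1.
Qed.

Lemma finite_spanning f n eps : compact [set: X] -> continuous f -> 0 < eps ->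
  exists2 E : set X, spanning f n eps E & finite_set E.
Proof.
move=> /compact_near_coveringP cX cf eps0.
(* Finite lists directed by inclusion: near-covering compactness along this filter yields a single
   list that serves every point. *)
pose F : set_system (seq X) :=
  filter_from setT (fun s : seq X => [set t : seq X | {subset s <= t}]).
have FF : Filter F.
  apply: filter_from_filter; first by exists [::].
  move=> s t _ _; exists (s ++ t) => // u /= stu.
  by split => x xs; apply: stu; rewrite mem_cat xs ?orbT.
have [|s _ /(_ s)] := cX _ F
    (fun s x => exists2 z, z \in s & orbit_close f n eps z x) FF.
  move=> x _; exists ([set x' | orbit_close f n eps x x'], [set s | x \in s]).
    split=> /=; last by exists [:: x] => // t /=; apply; rewrite inE.
    elim: n => [|n IHn]; first by near=> x'.
    near=> x' => k; rewrite ltnS leq_eqVlt => /orP[/eqP->|kn].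
      apply: ltW; near: x'.
      exact: (@iter_continuous _ _ f n cf x _ (near_mdist_lt _ eps0)).
    by move: k kn; near: x'.
  by move=> [x' t] [/= xx' xt]; exists x.
move=> /(_ (fun x xs => xs)) sP; exists [set` s]; last exact: finite_seq.
by move=> y; have [x xs xy] := sP y I; exists x.
Unshelve. all: by end_near.
Qed.

Lemma spanning_numberP f n eps : compact [set: X] -> continuous f -> 0 < eps ->
  spanning_cardinals f n eps (spanning_number f n eps) /\
  forall k, spanning_cardinals f n eps k -> (spanning_number f n eps <= k)%N.
Proof.
move=> cX cf eps0; rewrite /spanning_number.
apply: (@xgetPex _ 0%N [set m | spanning_cardinals f n eps m /\
    forall k : nat, spanning_cardinals f n eps k -> (m <= k)%N]).
have [E sE /finite_setP[m Em]] := finite_spanning n cX cf eps0.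
have : exists m, `[< spanning_cardinals f n eps m >].
  by exists m; apply/asboolP; exists E.
move=> /ex_minnP[l /asboolP sl lmin]; exists l; split=> // k sk.
by apply: lmin; apply/asboolP.
Qed.

Lemma spanning_number_nonincreasing f n eps eps' :
  compact [set: X] -> continuous f -> 0 < eps -> eps <= eps' ->
  (spanning_number f n eps' <= spanning_number f n eps)%N.
Proof.
move=> cX cf eps0 epseps'.
have [[E sE Em] _] := spanning_numberP n cX cf eps0.
have [_ ] := spanning_numberP n cX cf (lt_le_trans eps0 epseps').
apply; exists E => // y; have [x Ex xy] := sE y.
by exists x => //; exact: orbit_close_weaken xy.
Qed.

Lemma separated_spanning_number f n e eps k p :
  compact [set: X] -> continuous f -> 0 < eps -> eps + eps <= e ->
  separated f n e k p -> (k <= spanning_number f n eps)%N.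
Proof.
move=> cX cf eps0 epse sp.
have [[E sE Em] _] := spanning_numberP n cX cf eps0.
by apply: separated_card sp epse sE Em.
Qed.

End shadowing.

(** * Linear growth of separated families under expansivity *)

Section expansive_growth.
Context {R : realType} {X : metricType R} (f : homeomorphism X).
Implicit Types (x y : X) (e eta : R) (p : nat -> X).
Let g := homeo_inv f.

Lemma iter_homeo_funK k : cancel (iter k f) (iter k g).
Proof.
by elim: k => [|k IHk] x //; rewrite iterSr /= [g _]homeo_funK IHk.
Qed.

Lemma iter_homeo_invK k : cancel (iter k g) (iter k f).
Proof.
by elim: k => [|k IHk] x //; rewrite iterSr /= homeo_invK IHk.
Qed.

Lemma iter_homeo_invB m k x : (m <= k)%N ->
  iter m f (iter k g x) = iter (k - m) g x.
Proof. by move=> mk; rewrite -{1}(subnKC mk) iterD iter_homeo_invK. Qed.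

Lemma iter_homeo_funB m k x : (m <= k)%N ->
  iter k f (iter m g x) = iter (k - m) f x.
Proof. by move=> mk; rewrite -{1}(subnK mk) iterD iter_homeo_invK. Qed.

Lemma homeo_iter_continuous (n : int) : continuous (homeo_iter f n).
Proof.
case: n => k; apply: iter_continuous.
  exact: homeo_fun_continuous.
exact: homeo_inv_continuous.
Qed.

Definition expansivity_constant (delta : R) := forall x y,
  (forall n : int, mdist (homeo_iter f n x) (homeo_iter f n y) < delta) ->
  x = y.

(** A pair at distance at least [eta] is [delta] apart at some time [n], hence nearby pairs are more
    than [e] apart at that time; compactness of the square bounds [n]. The window from [-N] to [N]
    is written as [N.*2.+1] steps from the [N]-th preimages. *)
Lemma uniform_expansivity delta e eta : compact [set: X] ->
  expansivity_constant delta -> e < delta -> 0 < eta ->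
  exists N, forall x y,
    orbit_close f (N.*2.+1) e (iter N g x) (iter N g y) -> mdist x y <= eta.
Proof.
move=> cX fdelta edelta eta0.
have /compact_near_coveringP := compact_setX cX cX.
rewrite setXTT.
move=> /(_ _ \oo (fun N (q : X * X) =>
  orbit_close f (N.*2.+1) e (iter N g q.1) (iter N g q.2) ->
  mdist q.1 q.2 <= eta)).
move=> /(_ _)[|N _ /(_ N (leqnn N)) NP]; last first.
  by exists N => x y; exact: (NP (x, y)).
move=> [x y] _.
have [xy|xy] := ltP (mdist x y) eta.
  exists ([set q | mdist q.1 q.2 < eta], setT).
    split; last exact: filterT.
    exact: (cvgr_lt (mdist x y) (@mdist_continuous _ _ (x, y))).
  by move=> [q N] [/= /ltW].
have [n dn] : exists n : int,
    delta <= mdist (homeo_iter f n x) (homeo_iter f n y).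
  apply: contrapT => /forallNP H; have xE : x = y.
    by apply: fdelta => n; rewrite ltNge; apply/negP.
  by move: xy; rewrite xE mdistxx; lra.
exists ([set q | e < mdist (homeo_iter f n q.1) (homeo_iter f n q.2)],
        [set N | (absz n < N)%N]).
  split; last by exists (absz n).+1.
  have cn := @mdist_comp_continuous _ _ _ (@homeo_iter_continuous n) (x, y).
  apply: (cvgr_gt _ cn).
  exact: lt_le_trans dn.
move=> [[x' y'] N] [/= + nN] cxy; rewrite ltNge => /negP[].
(* Time [n] sits at position [N + n] of the window. *)
case: n nN {dn} => k /= kN.
  have := cxy (N + k)%N; rewrite !iter_homeo_funB ?leq_addr// addKn; apply; lia.
have := cxy (N - k.+1)%N; rewrite !iter_homeo_invB ?leq_subr// subKn; last lia.
by apply; lia.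
Qed.

Section extension.
Context (delta e : R) (N : nat).
Hypotheses (fdelta : expansivity_constant delta) (e0 : 0 < e)
  (edelta : e < delta).
Hypothesis uN : forall x y,
  orbit_close f N.*2.+1 e (iter N g x) (iter N g y) -> mdist x y <= e / 4.

(** Each time [N + j] with [j < n] is the centre of a window of length [N.*2.+1] inside the given
    one. *)
Lemma orbit_close_contract n x y : orbit_close f (n + N.*2) e x y ->
  orbit_close f n (e / 4) (iter N f x) (iter N f y).
Proof.
move=> xy j jn; rewrite -!iterD addnC !iterD; apply: uN.
rewrite !iter_homeo_funK; apply: orbit_close_iter.
by apply: orbit_close_weaken xy => //; lia.
Qed.

Lemma separated_extend n k p : infinite_set [set: X] -> (0 < n)%N ->
  separated f n e k p -> exists q, separated f (n + N.+1.*2) e k.+1 q.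
Proof.
move=> Xinf n0 sp; apply: contrapT => /forallNP nq; apply: Xinf.
(* [N] steps on each side are lost to contraction; the extra one leaves a gain of one step on each
   side. *)
pose G := iter N.+1 g.
(* Otherwise [y], appended at index [k], would give the excluded family of [k.+1] points. *)
have span y : exists2 i, (i < k)%N & orbit_close f (n + N.+1.*2) e (G (p i)) y.
  apply: contrapT => ny.
  apply: (nq (fun i => if (i < k)%N then G (p i) else y)) => i j.
  have GP i' j' : (i' < k)%N -> (j' < k)%N ->
      orbit_close f (n + N.+1.*2) e (G (p i')) (G (p j')) -> i' = j'.
    move=> i'k j'k Gij; apply: sp => //.
    rewrite -(iter_homeo_invK N.+1 (p i')) -(iter_homeo_invK N.+1 (p j')).
    by apply: orbit_close_iter; apply: orbit_close_weaken Gij => //; lia.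
  rewrite !ltnS; case: ltnP => ik; case: ltnP => jk ik' jk'.
  - exact: GP.
  - by move=> cij; case: ny; exists i.
  - by move=> /orbit_close_sym cij; case: ny; exists j.
  - by move=> _; lia.
have sharp y :
    exists2 i, (i < k)%N & orbit_close f n.+2 (e / 4) (g (p i)) (g y).
  have [i ik iy] := span (G y); exists i => //.
  have := @orbit_close_contract n.+2 (G (p i)) (G y).
  rewrite /G !iter_homeo_invB ?leqnSn// subSnn /=; apply.
  by apply: orbit_close_weaken iy => //; lia.
have shift y z c : orbit_close f n.+2 c (g y) (g z) -> orbit_close f n c y z.
  move=> cyz; rewrite -(homeo_invK f y) -(homeo_invK f z).
  apply: (@orbit_close_iter _ _ _ 1).
  by apply: orbit_close_weaken cyz => //; lia.
(* The points [p i] and [p j] near [y] and [z] are within [e / 4 + e / 2 + e / 4 = e] of each other,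
   so they coincide; passing through this common point costs only [e / 4 + e / 4] on the longer
   window. *)
have step y z : orbit_close f n (e / 2) y z ->
    orbit_close f n.+2 (e / 2) (g y) (g z).
  move=> yz; have [[i ik iy] [j jk jz]] := (sharp y, sharp z).
  have ij : i = j.
    apply: sp => //.
    apply: (@orbit_close_trans _ _ _ _ (e / 4) (3 * e / 4) _ y);
      [lra|exact: shift|].
    apply: (@orbit_close_trans _ _ _ _ (e / 2) (e / 4) _ z) => //; [lra|].
    by apply: orbit_close_sym; exact: shift.
  subst j; apply: orbit_close_trans (orbit_close_sym iy) jz; lra.
have eq y z : orbit_close f n (e / 2) y z -> y = z.
  move=> yz; apply: fdelta => m.
  apply: (@le_lt_trans _ _ (e / 2)); last by move: e0 edelta; lra.
  (* The first [n] of the [n.+2] steps form the window moved back by one, the last [n] the window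
     moved forward by one. *)
  have bwd l : orbit_close f n (e / 2) (iter l g y) (iter l g z).
    by elim: l => [//|l /step]; apply: orbit_close_weaken => //; lia.
  have fwd l : orbit_close f n (e / 2) (iter l f y) (iter l f z).
    elim: l => [//|l /step cl] /=.
    rewrite -{1}(homeo_invK f (iter l f y)) -{1}(homeo_invK f (iter l f z)).
    by apply: (@orbit_close_iter _ _ _ 2).
  by case: m => l; [exact: (fwd l 0%N)|exact: (bwd l.+1 0%N)].
(* Every point is now one of the [p i], against the infinitude of the space. *)
apply: (@sub_finite_set _ _ (p @` `I_k)); last exact/finite_image/finite_II.
move=> y _; have [i ik iy] := sharp y; exists i => //.
by apply: eq; apply: orbit_close_weaken (shift _ _ _ iy) => //; move: e0; lra.
Qed.

Lemma separated_linear : infinite_set [set: X] ->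
  forall k, exists p, separated f (1 + k * N.+1.*2) e k.+1 p.
Proof.
move=> Xinf; elim=> [|k [p sp]].
  have [x _] := infinite_setN0 Xinf.
  by exists (fun=> x) => i j; lia.
by have [//|q sq] := separated_extend Xinf _ sp; exists q;
  apply: separated_leq sq; lia.
Qed.

End extension.

End expansive_growth.

(** * Upper limits and monotonicity in [eps] *)

Section entropy.
Context {R : realType} {X : metricType R}.

Lemma ln_nat_ge0 n : 0 <= ln n%:R :> R.
Proof. by case: n => [|n]; [rewrite ln0|rewrite ln_ge0// ler1n]. Qed.

Lemma ler_ln_nat m n : (m <= n)%N -> ln m%:R <= ln n%:R :> R.
Proof.
case: m => [_|m mn]; first by rewrite [leLHS]ln0// ln_nat_ge0.
by rewrite ler_ln ?posrE ?ltr0n ?ler_nat// (leq_trans _ mn).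
Qed.

(** Along [n = M ^ i.+1] the quotient is at least [i / i.+1], which tends to 1. *)
Lemma limn_esup_ge1 (M : nat) (s : nat -> nat) : (1 < M)%N ->
  (forall j, M ^ j <= s (M ^ j.+1))%N ->
  (1 <= limn_esup (fun n => (ln (s n)%:R / ln n%:R : R)%:E))%E.
Proof.
move=> M1 sM; apply: le_ereal_inf_tmp => _ [V [n0 _ Vn0] <-].
apply/lee_addgt0Pr => e e0.
have [j ej] : exists j : nat, e^-1 < j%:R.
  by exists (Num.truncn e^-1).+1; rewrite truncnS_gt.
(* [j] makes [1 / i.+1] at most [e], and [n0] puts [n] into the tail [V]. *)
pose i := (j + n0)%N; pose n := (M ^ i.+1)%N.
have Vn : V n.
  by apply: Vn0 => /=; have := ltn_expl i.+1 M1; rewrite /n /i; lia.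
apply: (@le_trans _ _ ((ln (s n)%:R / ln n%:R)%:E + e%:E)%E); last first.
  by rewrite leeD2r//; apply: ereal_sup_ubound; exists n.
have lnM0 : 0 < ln M%:R :> R by rewrite ln_gt0 // ltr1n.
have lnn : ln n%:R = i.+1%:R * ln M%:R :> R.
  by rewrite natrX lnXn ?ltr0n 1?ltnW// mulr_natl.
have lns : i%:R * ln M%:R <= ln (s n)%:R :> R.
  by rewrite mulr_natl -lnXn ?ltr0n 1?ltnW// -natrX ler_ln_nat.
rewrite -EFinD lee_fin -lerBlDr lnn ler_pdivlMr ?mulr_gt0//.
apply: le_trans lns; rewrite mulrA ler_pM2r//.
have : 1 <= e * i.+1%:R.
  rewrite -ler_pdivrMl// mulr1; apply: le_trans (ltW ej) _.
  by rewrite ler_nat /i; lia.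
by rewrite -(@natr1 _ i); lra.
Qed.

Lemma le_limn_esup (u v : (\bar R)^nat) : (forall n, u n <= v n)%E ->
  (limn_esup u <= limn_esup v)%E.
Proof.
move=> uv; apply: le_ereal_inf_tmp => _ [V FV <-].
apply: (@le_trans _ _ (ereal_sup (u @` V))).
  by apply: ereal_inf_lbound; exists V.
apply: ge_ereal_sup => _ [n Vn <-]; apply: le_trans (uv n) _.
by apply: ereal_sup_ubound; exists n.
Qed.

Lemma pol_entropy_at_nonincreasing (f : X -> X) eps eps' :
  compact [set: X] -> continuous f -> 0 < eps -> eps <= eps' ->
  (pol_entropy_at f eps' <= pol_entropy_at f eps)%E.
Proof.
move=> cX cf eps0 epseps'; apply: le_limn_esup => n.
rewrite lee_fin ler_wpM2r ?invr_ge0 ?ln_nat_ge0//.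
by apply: ler_ln_nat; exact: spanning_number_nonincreasing.
Qed.

End entropy.

(** * The lower bound on polynomial entropy *)

Theorem theorem4p1 (R : realType) (X : metricType R) (f : homeomorphism X)
    (X_compact : compact [set: X]) (X_infinite : infinite_set [set: X])
    (f_expansive : expansive f) :
  (1 <= pol_entropy f)%E.
Proof.
have [delta delta0 fdelta] := f_expansive.
pose e := delta / 2; have e0 : 0 < e by rewrite /e; lra.
have edelta : e < delta by rewrite /e; lra.
have e4 : 0 < e / 4 by lra.
have cf : continuous f := @homeo_fun_continuous _ f.
have [N uN] := uniform_expansivity X_compact fdelta edelta e4.
apply: lime_ge.
  (* The limit at 0 exists by monotonicity, so a bound for all small [eps] suffices. *)
  apply: nonincreasing_at_right_is_cvge; near=> x => eps eps'.
  rewrite !in_itv /= => /andP[eps0 _] _.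
  exact: pol_entropy_at_nonincreasing.
near=> eps; apply: (@limn_esup_ge1 _ N.+1.*2); first by rewrite doubleS.
(* With [M = N.+1.*2], this gives [M ^ j] separated points of length [1 + (M ^ j - 1) * M], at most
   [M ^ j.+1]. *)
move=> j; have [p sp] := separated_linear fdelta e0 edelta uN X_infinite
  (N.+1.*2 ^ j).-1.
have Mj : (0 < N.+1.*2 ^ j)%N by rewrite expn_gt0.
rewrite -[X in (X <= _)%N](prednK Mj).
apply: (separated_spanning_number X_compact cf _ _
  (separated_leq _ sp)).
- by near: eps; exact: nbhs_right_gt.
- have : eps <= e / 2; last by lra.
  by near: eps; apply: nbhs_right_le; lra.
- by rewrite expnSr -{2}(prednK Mj) mulSn leq_add2r doubleS.
Unshelve. all: by end_near.
Qed.
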